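(* Soft groups (as objects), together with soft group homomorphisms between them (as morphisms), form a category, where the composite of soft group homomorphisms $(f,p):(F,A)_G\to(H,B)_K$ and $(g,q):(H,B)_K\to(L,C)_M$ is $(g\circ f,\,q\circ p)$ and the identity morphism of $(F,A)_G$ is $(1_G,1_A)$, with $1_G$ the identity homomorphism of $G$ and $1_A$ the identity map of $A$.
   Context: A soft group $(F,A)_G$ over a group $G$ is a pair consisting of a set $A$ of parameters (a subset of some set $E$ of parameters) and a function $F:A\to P(G)$ into the power set of $G$ such that $F(a)$ is a subgroup of $G$ for every $a\in A$. For a group homomorphism $f:G\to K$, $\hat f:P(G)\to P(K)$ denotes the direct image map $\hat f(S)=f(S)$. A soft group homomorphism $(f,p):(F,A)_G\to(H,B)_K$ is a pair consisting of a group homomorphism $f:G\to K$ and a function $p:A\to B$ such that $\hat f\circ F=H\circ p$. Two soft group homomorphisms $(f,p)$ and $(g,q)$ are equal if and only if $f=g$ and $p=q$. *)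

(* Defs.v *)
From HB Require Import structures.
From mathcomp Require Import all_boot.
From mathcomp Require Import boolp classical_sets.

Set Implicit Arguments.
Unset Strict Implicit.
Unset Printing Implicit Defensive.

Local Open Scope classical_set_scope.

(* Homomorphisms of possibly infinite groups. *)
Notation groupHom G K := (UMagmaMorphism.type G K).

(* [group_closed] is the library's notion of subgroup: it contains 1 and is
   closed under x / y.  The parameter set coerces to the subtype of its
   elements, which is the domain of [sg_map]. *)
Record softGroup : Type := SoftGroup {
  sg_group : groupType;
  sg_univ : Type;
  sg_params : set sg_univ;
  sg_map : sg_params -> set sg_group;
  sg_subgroup : forall a : sg_params, group_closed (mem (sg_map a)) }.

Arguments sg_params : clear implicits.
Arguments sg_map : clear implicits.

Definition hat (G K : Type) (f : G -> K) : set G -> set K := fun S => f @` S.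

Record softHom (X Y : softGroup) : Type := SoftHom {
  sh_hom : groupHom (sg_group X) (sg_group Y);
  sh_params : sg_params X -> sg_params Y;
  sh_comm : hat sh_hom \o sg_map X = sg_map Y \o sh_params }.

Lemma groupHom_eqP (G K : groupType) (f g : groupHom G K) :
  f = g <-> f = g :> (G -> K).
Proof.
split=> [-> //|].
case: f g => [f [[f1] [fM]]] [g [[g1] [gM]]] /= fg; subst g.
by rewrite (Prop_irrelevance f1 g1) (Prop_irrelevance fM gM).
Qed.

(* Leibniz equality of soft group homomorphisms is equality of both
   components. *)
Lemma softHom_eqP (X Y : softGroup) (m n : softHom X Y) :
  m = n <-> sh_hom m = sh_hom n /\ sh_params m = sh_params n.
Proof.
split=> [-> //|].
case: m n => [f p fp] [g q gq] /= [fg pq]; subst g q.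
by rewrite (Prop_irrelevance fp gq).
Qed.

Record is_category (ob : Type) (hom : ob -> ob -> Type)
    (id : forall X, hom X X)
    (comp : forall X Y Z, hom Y Z -> hom X Y -> hom X Z) : Prop := IsCategory {
  cat_assoc : forall X Y Z W (f : hom X Y) (g : hom Y Z) (h : hom Z W),
    comp X Z W h (comp X Y Z g f) = comp X Y W (comp Y Z W h g) f;
  cat_id_l : forall X Y (f : hom X Y), comp X Y Y (id Y) f = f;
  cat_id_r : forall X Y (f : hom X Y), comp X X Y f (id X) = f }.

Arguments is_category {ob} hom id comp.

(* Main.v *)
Require Import Defs.
From HB Require Import structures.
From mathcomp Require Import all_boot.
From mathcomp Require Import boolp classical_sets.

(** A soft group homomorphism is determined by its two underlying functions,
    the compatibility condition being a proposition ([softHom_ext]).  The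
    category laws therefore reduce to those of functions under composition,
    which hold by computation.  The only mathematical content is that the
    identity and composite pairs are again compatible, and this is the
    functoriality of the direct image: [hat idfun] is the identity, and
    [hat (g \o f)] is [hat g \o hat f], so that the commutative squares of two
    composable morphisms paste together. *)

Lemma hat_id (T : Type) : hat (@idfun T) = idfun.
Proof. by apply/funext => S; rewrite /hat image_id. Qed.

Lemma hat_comp (T U V : Type) (g : U -> V) (f : T -> U) :
  hat (g \o f) = hat g \o hat f.
Proof. by apply/funext => S; rewrite /hat /= image_comp. Qed.

Lemma softHom_ext (X Y : softGroup) (m n : softHom X Y) :
  sh_hom m = sh_hom n :> (sg_group X -> sg_group Y) ->
  sh_params m = sh_params n -> m = n.
Proof. by move=> /groupHom_eqP mn_hom mn_params; apply/softHom_eqP. Qed.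

Lemma soft_id_comm (X : softGroup) :
  hat (@idfun (sg_group X)) \o sg_map X = sg_map X \o idfun.
Proof. by rewrite hat_id. Qed.

Definition soft_id (X : softGroup) : softHom X X :=
  @SoftHom X X (idfun : groupHom (sg_group X) (sg_group X)) idfun
    (soft_id_comm X).

Lemma soft_comp_comm (X Y Z : softGroup) (g : softHom Y Z) (f : softHom X Y) :
  hat (sh_hom g \o sh_hom f) \o sg_map X
  = sg_map Z \o (sh_params g \o sh_params f).
Proof.
rewrite hat_comp; apply: etrans (congr1 (comp (hat (sh_hom g))) (sh_comm f)) _.
exact: (congr1 (fun h => h \o sh_params f) (sh_comm g)).
Qed.

Definition soft_comp (X Y Z : softGroup) (g : softHom Y Z) (f : softHom X Y) :
    softHom X Z :=
  @SoftHom X Z (sh_hom g \o sh_hom f : groupHom (sg_group X) (sg_group Z))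
    (sh_params g \o sh_params f) (soft_comp_comm X Y Z g f).

Lemma soft_is_category : is_category softHom soft_id soft_comp.
Proof. by split=> *; apply: softHom_ext. Qed.

Theorem proposition3p1 :
  exists (id : forall X : softGroup, softHom X X)
         (comp : forall X Y Z : softGroup,
            softHom Y Z -> softHom X Y -> softHom X Z),
    [/\ is_category softHom id comp,
        forall X : softGroup,
          sh_hom (id X) = idfun :> (sg_group X -> sg_group X) /\
          sh_params (id X) = idfun
      & forall (X Y Z : softGroup) (g : softHom Y Z) (f : softHom X Y),
          sh_hom (comp X Y Z g f) = sh_hom g \o sh_hom f
            :> (sg_group X -> sg_group Z) /\
          sh_params (comp X Y Z g f) = sh_params g \o sh_params f].
Proof.
exists soft_id, soft_comp; split=> //.
exact: soft_is_category.
Qed.
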